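(* Let $\mathcal{T}\le \mathrm{AGL}(V,+)$ be an elementary abelian regular subgroup and let $\circ$ be the operation it induces on $V$. Let $d=\dim(W(\mathcal{T}))$, $m=n-d$, and assume $W(\mathcal{T})=\mathrm{Span}\{e_{m+1},\dots,e_n\}$. Then $T_+\le \mathrm{AGL}(V,\circ)$ if and only if for every $M_y\in\Omega(\mathcal{T})$ there exists a matrix $B_y\in(\mathbb{F}_p)^{m\times d}$ such that $$M_y=\begin{pmatrix}1_m & B_y\\ 0 & 1_d\end{pmatrix}.$$
   Context: $p$ is a prime, $n\ge 2$, $V=(\mathbb{F}_p)^n$ with canonical basis $e_1,\dots,e_n$. Maps are written in postfix notation, vectors are row vectors, and matrices act on the right ($v\mapsto vM$). $1_k$ is the $k\times k$ identity matrix. $T=T_+=\{\sigma_a\mid a\in V\}$, where $\sigma_a:x\mapsto x+a$, is the translation group; $\mathrm{AGL}(V)=\mathrm{AGL}(V,+)=\mathrm{GL}(V)\ltimes T$. For an elementary abelian regular subgroup $\mathcal{T}\le\mathrm{Sym}(V)$, write $\mathcal{T}=\{\tau_a\mid a\in V\}$, where $\tau_a$ is the unique element of $\mathcal{T}$ sending $0$ to $a$. The induced operation on $V$ is $a\circ b=a\tau_b$; one writes $\mathcal{T}=T_\circ$, and $\mathrm{AGL}(V,\circ)$ denotes the normaliser of $\mathcal{T}$ in $\mathrm{Sym}(V)$. If $\mathcal{T}\le\mathrm{AGL}(V)$, then for each $a\in V$ there is a unique $M_a\in\mathrm{GL}(V)$ with $\tau_a=M_a\sigma_a$, i.e. $x\tau_a=xM_a+a$.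 Set $\Omega(\mathcal{T})=\{M_a\mid a\in V\}$ and $W(\mathcal{T})=\{a\in V\mid \sigma_a\in\mathcal{T}\}$, which is a subspace of $(V,+)$. *)

(* Defs.v *)
From HB Require Import structures.
From mathcomp Require Import all_boot all_order all_algebra all_fingroup all_solvable.
Set Implicit Arguments.
Unset Strict Implicit.
Unset Printing Implicit Defensive.
Import GRing.Theory.
Local Open Scope ring_scope.

(* Permutations compose from left to right in MathComp ([permM]), and matrices
   act on row vectors from the right, so postfix conventions carry over. *)

Section Defs.

Variables (p n : nat).
Local Notation V := ('rV['F_p]_n).

Definition sigma (a : V) : {perm V} := perm (addIr a).

Definition Tplus : {set {perm V}} := [set sigma a | a : V].

Definition GLV : {set {perm V}} :=
  [set s : {perm V} | [exists M : 'M['F_p]_n,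
              (M \in unitmx) && [forall x, s x == x *m M]]].

Definition AGL : {set {perm V}} := (GLV * Tplus)%g.

Definition regular (T : {set {perm V}}) : bool :=
  [transitive T, on [set: V] | 'P] && [forall x : V, ('C_T[x | 'P] == 1)%g].

(* The default value 1 is never used for regular T, see [tauP]. *)
Definition tau (T : {set {perm V}}) (a : V) : {perm V} :=
  odflt 1%g [pick t in T | t 0 == a].

Definition induced_op (T : {set {perm V}}) (a b : V) : V := tau T b a.

Definition translations (op : V -> V -> V) : {set {perm V}} :=
  [set s : {perm V} | [exists b, [forall x, s x == op x b]]].

(* AGL(V, op), the normaliser of T_op in Sym(V); when op is induced by a regular
   group T, T_op is T itself, see [translations_induced_op]. *)
Definition AGL_op (op : V -> V -> V) : {set {perm V}} := 'N(translations op)%g.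

(* The default value 1 is never used for regular T in AGL, see [linpartP]. *)
Definition linpart (T : {set {perm V}}) (a : V) : 'M['F_p]_n :=
  odflt 1%:M [pick M in unitmx | [forall x, tau T a x == x *m M + a]].

Definition Omega (T : {set {perm V}}) : {set 'M['F_p]_n} :=
  [set linpart T a | a : V].

(* The set of all a with sigma_a in T is already a subspace when T is a
   group, see [mem_W]; taking the span only gives it its type. *)
Definition W (T : {set {perm V}}) : {vspace V} :=
  <<enum [set a | sigma a \in T]>>%VS.

Lemma sigmaE a x : sigma a x = x + a.
Proof. by rewrite permE. Qed.

Lemma sigma0 : sigma 0 = 1%g.
Proof. by apply/permP => x; rewrite sigmaE perm1 addr0. Qed.

Lemma sigmaD a b : sigma (a + b) = (sigma a * sigma b)%g.
Proof. by apply/permP => x; rewrite permM !sigmaE addrA. Qed.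

Lemma Tplus_translations : Tplus = translations +%R.
Proof.
apply/setP => s; rewrite inE; apply/imsetP/existsP => [[a _ ->]|[a /forallP sE]].
  by exists a; apply/forallP => x; rewrite sigmaE.
by exists a => //; apply/permP => x; rewrite sigmaE; apply/eqP.
Qed.

Lemma regular_inj (T : {group {perm V}}) : regular T ->
  forall x s t, s \in T -> t \in T -> s x = t x -> s = t.
Proof.
case/andP => _ /forallP free x s t sT tT st.
have: (s * t^-1 \in 'C_T[x | 'P])%g.
  apply/setIP; split; first by rewrite groupM ?groupV.
  by apply/astab1P; rewrite /= /aperm permM st permK.
by rewrite (eqP (free x)) inE => /eqP/(canRL (mulgKV _)) ->; rewrite mul1g.
Qed.

Lemma tauP (T : {group {perm V}}) : regular T -> forall a t,
  (t \in T /\ t 0 = a) <-> t = tau T a.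
Proof.
move=> regT a t; have tr := (andP regT).1.
rewrite /tau; case: pickP => [s /andP[sT /eqP s0]|none] /=.
  split => [[tT t0]|-> //]; apply: (regular_inj regT (x := 0)) => //.
  by rewrite t0 s0.
have [s sT /= sa] := atransP2 tr (in_setT (0 : V)) (in_setT a).
by have:= none s; rewrite sT sa eqxx.
Qed.

Lemma translations_induced_op (T : {group {perm V}}) :
  regular T -> translations (induced_op T) = T.
Proof.
move=> regT; apply/setP => s; rewrite inE; apply/existsP/idP.
  case=> b /forallP sE; have -> : s = tau T b by apply/permP => x; apply/eqP/sE.
  by have [] := (tauP regT b _).2 erefl.
move=> sT; exists (s 0); apply/forallP => x.
by rewrite /induced_op -((tauP regT (s 0) s).1 (conj sT erefl)).
Qed.

Lemma linpartP (T : {group {perm V}}) : regular T -> T \subset AGL ->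
  forall a M,
  (M \in unitmx /\ forall x, tau T a x = x *m M + a) <-> M = linpart T a.
Proof.
move=> regT sTA a M; rewrite /linpart; case: pickP => [N /andP[uN /forallP NE]|none] /=.
  split=> [[uM ME]|->]; last by split=> // x; apply/eqP/NE.
  by apply/row_matrixP => i; rewrite !rowE; apply: (addIr a); rewrite -ME (eqP (NE _)).
have [tT t0] := (tauP regT a _).2 erefl.
have /mulsgP[g _ gG /imsetP[b _ ->] tE] := subsetP sTA _ tT.
move: gG; rewrite inE => /existsP[N /andP[uN /forallP gE]].
have bE : b = a by rewrite -t0 tE permM sigmaE (eqP (gE _)) mul0mx add0r.
have:= none N; rewrite uN /=; case/forallP => x.
by rewrite tE permM sigmaE (eqP (gE _)) bE.
Qed.

Lemma mem_W (T : {group {perm V}}) a :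
  (a \in W T) = (sigma a \in T).
Proof.
apply/idP/idP => [|aT]; last first.
  by apply: memv_span; rewrite mem_enum inE.
move=> /coord_span->; elim/big_ind: _ => [|x y xT yT|i _].
- by rewrite sigma0 group1.
- by rewrite sigmaD groupM.
set c := coord _ _ _; set v := _`_i.
have vT : sigma v \in T.
  have: v \in enum [set a | sigma a \in T] by rewrite mem_nth // -cardE.
  by rewrite mem_enum inE.
rewrite -[c]natr_Zp scaler_nat; elim: (nat_of_ord c) => [|k IH].
  by rewrite mulr0n sigma0 group1.
by rewrite mulrS sigmaD groupM.
Qed.

End Defs.

Arguments Tplus {p n}.
Arguments AGL {p n}.

(* Main.v *)
Require Import Defs.
From HB Require Import structures.
From mathcomp Require Import all_boot all_order all_algebra all_fingroup all_solvable.
Set Implicit Arguments.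
Unset Strict Implicit.
Unset Printing Implicit Defensive.
Import GRing.Theory.
Local Open Scope ring_scope.

(** Write [t : x |-> x M + a] for an element of [T].  Conjugation by [sigma b]
   keeps the linear part [M] and moves the translation part by [b - b M], that
   is, [t ^ sigma b = t * sigma (b - b M)] ([conj_sigma]).  Hence the
   translations normalise [T] if and only if [b - b M] lies in [W T] for all
   [b] and all [M] in [Omega T] ([Tplus_norm_sub_W]).  When [W T] is the space
   of vectors supported on the last [d] coordinates, this condition says that
   the left block column of [M] is that of the identity.  The lower right block
   is the identity in any case, since the commutativity of [T] forces every [M]
   in [Omega T] to fix [W T] pointwise ([Omega_fix_W]). *)

Section Affine.

Variables p n : nat.
Local Notation V := ('rV['F_p]_n).

Lemma conj_sigma (t : {perm V}) (M : 'M_n) (a b : V) :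
  (forall x, t x = x *m M + a) -> (t ^ sigma b = t * sigma (b - b *m M))%g.
Proof.
move=> tE; rewrite conjgE; apply: (canLR (mulKg _)).
apply/permP => x; rewrite !permM !sigmaE !tE mulmxDl.
rewrite -!addrA; congr (_ + _); rewrite [RHS]addrCA; congr (_ + _).
by rewrite addrCA subrr addr0.
Qed.

Variable T : {group {perm V}}.
Hypotheses (regT : regular T) (TA : T \subset AGL).

Lemma tau_in a : tau T a \in T.
Proof. by have [] := (tauP regT a _).2 erefl. Qed.

Lemma tau_affine a x : tau T a x = x *m linpart T a + a.
Proof. by have [_ ->] := (linpartP regT TA a _).2 erefl. Qed.

(** As [t] itself is in [T], the conjugate [t * sigma (b - b M)] of
   [conj_sigma] is in [T] exactly when its second factor is. *)
Lemma Tplus_norm_sub_W :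
  Tplus \subset 'N(T)%g <->
  (forall M, M \in Omega T -> forall b, b - b *m M \in W T).
Proof.
split=> [nT _ /imsetP[a _ ->] b | subW].
  have sN : sigma b \in 'N(T)%g by apply: (subsetP nT); apply: imset_f.
  rewrite mem_W -(groupMl _ (tau_in a)) -(conj_sigma b (tau_affine a)).
  by rewrite memJ_norm // tau_in.
apply/subsetP => _ /imsetP[b _ ->]; rewrite inE.
apply/subsetP => _ /imsetP[t tT ->].
have -> : t = tau T (t 0) by apply/(tauP regT).
rewrite (conj_sigma b (tau_affine _)) groupMl ?tau_in // -mem_W.
by apply: subW; apply: imset_f.
Qed.

(** For [w] in [W T], the translation [sigma w] commutes with
   [t : x |-> x M + a]; at [0] this reads [a + w = w M + a]. *)
Lemma Omega_fix_W M w :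
  abelian T -> M \in Omega T -> w \in W T -> w *m M = w.
Proof.
move=> /centsP cT /imsetP[a _ ->]; rewrite mem_W => wT.
have /permP/(_ 0) := cT _ (tau_in a) _ wT.
rewrite !permM !sigmaE !tau_affine mul0mx !add0r addrC.
by move/addIr/esym.
Qed.

End Affine.

Lemma mem_span_rshift (F : fieldType) m d (v : 'rV[F]_(m + d)) :
  (v \in <<[seq (delta_mx 0 (rshift m i))%R | i : 'I_d]>>%VS) =
  (lsubmx v == 0).
Proof.
apply/idP/eqP => [/coord_span-> | v0].
  rewrite linear_sum big1 // => i _; rewrite linearZ /=.
  set e := _`_i.
  have /mapP[j _ ->] : e \in [seq delta_mx 0 (rshift m i) | i : 'I_d].
    by apply: mem_nth; rewrite size_map -cardE ltn_ord.
  apply/rowP => k; rewrite !mxE eqxx /=.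
  by rewrite eq_lrshift mulr0.
rewrite [v]row_sum_delta big_split_ord /= rpredD //.
  apply: rpred_sum => j _; have /rowP/(_ j) := v0; rewrite !mxE => ->.
  by rewrite scale0r rpred0.
by apply: rpred_sum => j _; apply/rpredZ/memv_span/image_f.
Qed.

Theorem theorem3p11 (p m d : nat) (p_pr : prime p) (n_ge2 : (2 <= m + d)%N)
    (T : {group {perm 'rV['F_p]_(m + d)}})
    (abelT : is_abelem T) (regT : regular T) (TA : T \subset AGL)
    (dimW : \dim (W T) = d)
    (WE : W T = <<[seq (delta_mx 0 (rshift m i))%R | i : 'I_d]>>%VS) :
  Tplus \subset AGL_op (induced_op T) <->
  (forall M : 'M['F_p]_(m + d), M \in Omega T ->
     exists B : 'M['F_p]_(m, d), M = block_mx 1%:M B 0 1%:M).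
Proof.
have memW v : (v \in W T) = (lsubmx v == 0) by rewrite WE mem_span_rshift.
rewrite /AGL_op translations_induced_op //.
apply: (iff_trans (Tplus_norm_sub_W regT TA)).
split=> [subW M MO | blockM M MO b]; last first.
  have [B ->] := blockM M MO.
  rewrite memW -[b]hsubmxK mul_row_block !mulmx1 mulmx0 addr0.
  by rewrite opp_row_mx add_row_mx row_mxKl subrr.
exists (rsubmx (usubmx M)).
(* The condition is tested on the first m basis vectors, where v *m M is a row
   of the upper half of M. *)
have uM : lsubmx (usubmx M) = 1%:M.
  apply/row_matrixP => i; have := subW M MO (row_mx (delta_mx 0 i) 0).
  rewrite memW linearB subr_eq0 /= row_mxKl -{1}[M]vsubmxK mul_row_col mul0mx.
  rewrite addr0 -{1}[usubmx M]hsubmxK mul_mx_row row_mxKl -rowE row1.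
  by move/eqP.
(* The last d basis vectors lie in W T, so M fixes them. *)
have dM : dsubmx M = row_mx 0 1%:M.
  apply/row_matrixP => i; rewrite row_row_mx row0 row1.
  have wW : row_mx 0 (delta_mx 0 i) \in W T by rewrite memW row_mxKl.
  have := Omega_fix_W regT TA (abelem_abelian abelT) MO wW.
  by rewrite -{1}[M]vsubmxK mul_row_col mul0mx add0r -rowE.
by rewrite block_mxEv -uM -dM hsubmxK vsubmxK.
Qed.
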